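(* Let $n$ be a positive integer, $p$ a prime, $k\in\mathbb N$, and $\mathbf a=(a_1,\ldots,a_n)\in\mathbb N^n$ a vector. Suppose that $0<a_i\leq a_{i+1}$ for each $1\leq i\leq n-1$. Let $0<t\leq n/2$ be an integer, $T\in\mathcal H_t$, and assume that $\sum_{i\in T}a_i<p$. Then $\mathbf x_T$ is a lexicographic leading monomial for $S_p(\mathbf a,k)$. In particular, the conclusion holds when $\sum_{i\in[2t-1]}a_i\leq p$.
   Context: Natural numbers include $0$, and $[m]=\{1,\ldots,m\}$. Put $$S_p(\mathbf a,k)=\Big\{\mathbf v\in\{0,1\}^n:\ \sum_{i=1}^n a_iv_i\equiv k\pmod p\Big\}\subset\mathbb Q^n .$$ For an integer $t$ with $0<t\leq n/2$, $\mathcal H_t$ is the set of those subsets $\{s_1<s_2<\cdots<s_t\}$ of $[n]$ for which $t$ is the smallest index $j$ with $s_j<2j$. (For example $\mathcal H_1=\{\{1\}\}$, $\mathcal H_2=\{\{2,3\}\}$.) For $G\subseteq[n]$ write $\mathbf x_G=\prod_{j\in G}x_j$. For a finite set $V\subseteq\mathbb Q^n$, $I(V)$ denotes the ideal of all $f\in\mathbb Q[x_1,\ldots,x_n]$ vanishing at every point of $V$. The lexicographic order $\prec_l$ on monomials is defined by $x_1^{i_1}\cdots x_n^{i_n}\prec_l x_1^{j_1}\cdots x_n^{j_n}$ iff $i_m<j_m$ for the smallest index $m$ with $i_m\neq j_m$ (so $x_1\succ_l\cdots\succ_l x_n$). The leading monomial of a nonzero polynomial is the $\prec_l$-largest monomial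 occurring in it with nonzero coefficient. A monomial is a lexicographic leading monomial for $V$ if it is the leading monomial of some nonzero $f\in I(V)$.
   Formalization: In the ''In particular'' sentence, the case t = 1 requires the strict inequality a_1 < p, since the claim fails for t = 1, a_1 = p (e.g. n = 2, p = 2, a = (2,2), k = 0). *)

(* Defs.v *)
From HB Require Import structures.
From mathcomp Require Import all_boot all_order all_algebra.
From mathcomp Require Import finmap.
From mathcomp Require Import mpoly.

Set Implicit Arguments.
Unset Strict Implicit.
Unset Printing Implicit Defensive.

Import GRing.Theory.

(* Coordinates are indexed by 'I_n: the ordinal i stands for the index i + 1
   of [n] = {1, ..., n}. *)

Definition bool_point (n : nat) (w : {ffun 'I_n -> bool}) : 'rV[rat]_n :=
  (\row_(i < n) (w i)%:R)%R.

Definition Smod (n p : nat) (a : 'I_n -> nat) (k : nat) : {fset 'rV[rat]_n} :=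
  [fset bool_point w | w in [set w : {ffun 'I_n -> bool} |
     \sum_(i < n) a i * w i == k %[mod p]]]%fset.

(* [elt T j] is s_j, where T = {s_1 < s_2 < ...} is read as a subset of
   {1, ..., n}; junk value 0 for j > #|T|.  [enum T] is increasing. *)
Definition elt (n : nat) (T : {set 'I_n}) (j : nat) : nat :=
  nth 0 [seq (val i).+1 | i <- enum T] j.-1.

Definition calH (n t : nat) : {set {set 'I_n}} :=
  [set T : {set 'I_n} | [&& #|T| == t, elt T t < 2 * t &
     [forall j : 'I_t, (0 < j) ==> ~~ (elt T j < 2 * j)]]].

Definition in_ideal (n : nat) (V : {fset 'rV[rat]_n}) (f : {mpoly rat[n]}) :
    Prop :=
  forall v : 'rV[rat]_n, v \in V -> (f.@[v 0] = 0)%R.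

(* The order built into mpoly (hence mlead) compares total degrees first, so
   the purely lexicographic order is defined here. *)
Definition lex_lt (n : nat) (m1 m2 : 'X_{1..n}) : bool :=
  [exists i : 'I_n, (m1 i < m2 i) && [forall j : 'I_n, (j < i) ==> (m1 j == m2 j)]].

Definition is_lex_lead (n : nat) (f : {mpoly rat[n]}) (m : 'X_{1..n}) : Prop :=
  m \in msupp f /\
  forall m' : 'X_{1..n}, m' \in msupp f -> m' != m -> lex_lt m' m.

Definition lex_leading_monomial (n : nat) (V : {fset 'rV[rat]_n})
    (m : 'X_{1..n}) : Prop :=
  exists f : {mpoly rat[n]}, [/\ f != 0%R, in_ideal V f & is_lex_lead f m].

(* Exponent vector of the product of the variables 'X_j for j in G. *)
Definition xmon (n : nat) (G : {set 'I_n}) : 'X_{1..n} :=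
  (\sum_(j in G) U_(j))%MM.

(* Main.v *)
Require Import Defs.
From mathcomp Require Import all_boot all_order all_algebra.
From mathcomp Require Import finmap.
From mathcomp Require Import mpoly.
From mathcomp Require Import zify ring.

Set Implicit Arguments.
Unset Strict Implicit.
Unset Printing Implicit Defensive.

Import GRing.Theory.

(** The statement is a claim about the lex game on the 0-1 vectors of length n.
    Two players, Lea and Stan, choose the coordinates from the last one down to
    the first: Lea chooses those in T, Stan the others, each of them knowing the
    coordinates already chosen. Lea wins if the resulting vector lies outside V.

    A winning strategy for Lea gives a polynomial with leading monomial x_T in
    I(V). To choose w_i is to forbid one of its two values; the forbidden value
    depends on the w_j with j > i, so it is the value at w of a polynomial q_i
    in the variables x_j, j > i ([interpolation]). Every point of V has a
    coordinate in T with the forbidden value, so the product over i in T of the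
    x_i - q_i vanishes on V; each factor has leading monomial x_i, since x_i is
    lexicographically larger than all monomials in later variables
    ([lex_leading_of_strategy]).

    For V = S_p(a, k), what matters when w_i is to be chosen is the residue that
    the coordinates up to i still have to contribute. Write T_i and S_i for the
    sums of the a_j with j < i over j in T and over j not in T. Lea keeps the
    following true for each i: if the final vector lies in V, then the
    contribution of the coordinates before i is congruent to an integer between
    T_i and S_i. Reading the game backwards, a coordinate of Stan lengthens the
    interval on the right by a_i. At a coordinate of Lea, a residue that is not
    in both the interval [T_i, S_i] and its translate by a_i can be moved out of
    the interval by one of the choices w_i = 0 and w_i = 1. If
    S_i - T_i + a_i < p, then the interval and its translate meet modulo p only
    where they meet as sets of integers, namely in [T_i + a_i, S_i].
    Lea wins as soon as this interval is empty ([lea_wins]).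

    Both requirements come from S_i + a_i <= sum_{j in T} a_j for i in T
    ([calH_dominates]). The definition of H_t is a ballot condition: counted
    from 2t - 1 downwards, the elements of T always outnumber the other ones.
    Hence for every j the set made of i and the non-elements of T before i has
    at most as many members beyond j as T has, and a nondecreasing weight
    preserves such a domination ([sum_dominated]). The right-hand side is
    smaller than p by assumption, and for i the largest element 2t - 1 of T the
    inequality says that the interval is empty after i has been dealt with. *)

(** * The lexicographic order and leading monomials of products *)

Lemma lex_ltP (n : nat) (m1 m2 : 'X_{1..n}) :
  reflect (exists2 i : 'I_n, m1 i < m2 i &
             forall j : 'I_n, j < i -> m1 j = m2 j)
          (lex_lt m1 m2).
Proof.
apply: (iffP existsP) => [[i /andP[lti /forallP eqi]]|[i lti eqi]]; exists i => //.
  by move=> j ji; apply/eqP; move: (eqi j); rewrite ji.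
by rewrite lti /=; apply/forallP=> j; apply/implyP=> /eqi ->.
Qed.

Lemma lex_lt_irr (n : nat) (m : 'X_{1..n}) : lex_lt m m = false.
Proof. by apply/lex_ltP => -[i]; rewrite ltnn. Qed.

Lemma lex_lt_addl (n : nat) (m m1 m2 : 'X_{1..n}) :
  lex_lt m1 m2 -> lex_lt (m + m1)%MM (m + m2)%MM.
Proof.
move=> /lex_ltP[i lti eqi]; apply/lex_ltP; exists i.
  by rewrite !mnmDE ltn_add2l.
by move=> j ji; rewrite !mnmDE eqi.
Qed.

Lemma lex_lt_trans (n : nat) (m2 m1 m3 : 'X_{1..n}) :
  lex_lt m1 m2 -> lex_lt m2 m3 -> lex_lt m1 m3.
Proof.
move=> /lex_ltP[i lti eqi] /lex_ltP[j ltj eqj]; apply/lex_ltP.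
case: (ltngtP i j) => [ij|ji|/val_inj eij].
- exists i => [|l li]; first by rewrite -eqj.
  by rewrite eqi // eqj // (ltn_trans li).
- exists j => [|l lj]; first by rewrite eqi.
  by rewrite eqi ?eqj // (ltn_trans lj).
- rewrite -eij in ltj eqj.
  by exists i => [|l li]; [exact: ltn_trans ltj | rewrite eqi ?eqj].
Qed.

Definition lex_below (n : nat) (m : 'X_{1..n}) (r : {mpoly rat[n]}) : Prop :=
  forall m' : 'X_{1..n}, m' \in msupp r -> lex_lt m' m.

(** Leading monomial m with leading coefficient 1. Unlike [is_lex_lead] alone,
    this form is preserved by products through a mere expansion around the
    leading terms, without computing a coefficient of the product. *)
Definition lex_monic (n : nat) (m : 'X_{1..n}) (f : {mpoly rat[n]}) : Prop :=
  lex_below m (f - 'X_[m])%R.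

Lemma lex_belowD (n : nat) (m : 'X_{1..n}) (f g : {mpoly rat[n]}) :
  lex_below m f -> lex_below m g -> lex_below m (f + g)%R.
Proof.
move=> hf hg m' /msuppD_le; rewrite mem_cat => /orP[/hf|/hg] //.
Qed.

Lemma lex_belowXM (n : nat) (m m' : 'X_{1..n}) (r : {mpoly rat[n]}) :
  lex_below m' r -> lex_below (m + m')%MM ('X_[m] * r)%R.
Proof.
move=> hr m'' /msuppM_le /allpairsP[[u v] /= [uin vin ->]].
move: uin; rewrite msuppX inE => /eqP ->.
exact/lex_lt_addl/hr.
Qed.

Lemma lex_belowM (n : nat) (m m' : 'X_{1..n}) (f g : {mpoly rat[n]}) :
  lex_below m f -> lex_below m' g -> lex_below (m + m')%MM (f * g)%R.
Proof.
move=> hf hg m'' /msuppM_le /allpairsP[[u v] /= [uin vin ->]].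
apply: (@lex_lt_trans _ (u + m')%MM); first exact/lex_lt_addl/hg.
by rewrite ![(_ + m')%MM]addmC; apply/lex_lt_addl/hf.
Qed.

Lemma lex_monicM (n : nat) (m m' : 'X_{1..n}) (f g : {mpoly rat[n]}) :
  lex_monic m f -> lex_monic m' g -> lex_monic (m + m')%MM (f * g)%R.
Proof.
rewrite /lex_monic => hf hg.
have -> : (f * g - 'X_[m + m'] = 'X_[m] * (g - 'X_[m']) + 'X_[m'] * (f - 'X_[m])
   + (f - 'X_[m]) * (g - 'X_[m']))%R by rewrite mpolyXD; ring.
apply: lex_belowD; last exact: lex_belowM.
apply: lex_belowD; first exact: lex_belowXM.
by rewrite addmC; apply: lex_belowXM.
Qed.

Lemma lex_monic1 (n : nat) : lex_monic 0%MM (1 : {mpoly rat[n]})%R.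
Proof. by move=> m; rewrite mpolyX0 subrr msupp0. Qed.

Lemma lex_monic_lead (n : nat) (m : 'X_{1..n}) (f : {mpoly rat[n]}) :
  lex_monic m f -> is_lex_lead f m.
Proof.
move=> hf; have mNr : m \notin msupp (f - 'X_[m])%R.
  by apply/negP => /hf; rewrite lex_lt_irr.
have fE : f = ('X_[m] + (f - 'X_[m]))%R by ring.
split.
  rewrite fE mcoeff_msupp mcoeffD (memN_msupp_eq0 mNr) mcoeffX eqxx.
  by rewrite addr0 oner_neq0.
move=> m'; rewrite {1}fE => /msuppD_le; rewrite mem_cat msuppX inE.
by case/orP=> [/eqP -> /eqP //|/hf].
Qed.

(** * From strategies to polynomials *)

Definition vars_in (n : nat) (D : {set 'I_n}) (q : {mpoly rat[n]}) : Prop :=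
  forall m : 'X_{1..n}, m \in msupp q -> forall j, j \notin D -> m j = 0.

Lemma vars_in_const (n : nat) (D : {set 'I_n}) (c : rat) : vars_in D c%:MP%R.
Proof.
move=> m; rewrite msuppC; case: ifP => // _.
by rewrite inE => /eqP -> j _; rewrite mnm0E.
Qed.

Lemma vars_inX (n : nat) (D : {set 'I_n}) (i : 'I_n) :
  i \in D -> vars_in D 'X_i%R.
Proof.
move=> iD m; rewrite msuppX inE => /eqP -> j jD; rewrite mnm1E.
by case: eqP => // ij; rewrite -ij iD in jD.
Qed.

Lemma vars_inD (n : nat) (D : {set 'I_n}) (q r : {mpoly rat[n]}) :
  vars_in D q -> vars_in D r -> vars_in D (q + r)%R.
Proof. by move=> hq hr m /msuppD_le; rewrite mem_cat => /orP[/hq|/hr]. Qed.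

Lemma vars_inN (n : nat) (D : {set 'I_n}) (q : {mpoly rat[n]}) :
  vars_in D q -> vars_in D (- q)%R.
Proof. by move=> hq m; rewrite (perm_mem (msuppN q)); apply: hq. Qed.

Lemma vars_inM (n : nat) (D : {set 'I_n}) (q r : {mpoly rat[n]}) :
  vars_in D q -> vars_in D r -> vars_in D (q * r)%R.
Proof.
move=> hq hr m /msuppM_le /allpairsP[[u v] /= [uin vin ->]] j jD.
by rewrite mnmDE (hq u) ?(hr v).
Qed.

(** The product over j in D of x_j (for j in W) or 1 - x_j (for j outside W) is
    on 0-1 vectors the indicator function of the support meeting D exactly in W;
    sum these with coefficients phi W over all subsets W of D. *)
Lemma interpolation (n : nat) (D : {set 'I_n}) (phi : {set 'I_n} -> rat) :
  exists2 q : {mpoly rat[n]}, vars_in D q &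
    forall w : {ffun 'I_n -> bool},
      q.@[bool_point w 0%R]%R = phi (D :&: [set j | w j]).
Proof.
pose lit (W : {set 'I_n}) j : {mpoly rat[n]} :=
  (if j \in W then 'X_j else 1%:MP - 'X_j)%R.
exists (\sum_(W in powerset D) (phi W)%:MP * \prod_(j in D) lit W j)%R.
  apply: big_ind => [|q r|W _]; [exact: vars_in_const|exact: vars_inD|].
  apply: vars_inM; first exact: vars_in_const.
  apply: big_ind => [|q r|j jD]; [exact: vars_in_const|exact: vars_inM|].
  rewrite /lit; case: ifP => _; first exact: vars_inX.
  apply: vars_inD; first exact: vars_in_const.
  exact/vars_inN/vars_inX.
move=> w; set W0 := D :&: _; rewrite raddf_sum /=.
have litE W j : ((lit W j).@[bool_point w 0] = ((j \in W) == w j)%:R :> rat)%R.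
  rewrite /lit; case: ifP => _.
    by rewrite mevalXU mxE; case: (w j).
  by rewrite mevalB mevalC mevalXU mxE; case: (w j); rewrite ?subrr ?subr0.
have W0D : W0 \in powerset D by rewrite powersetE subsetIl.
rewrite (bigD1 W0) //= [X in (_ + X)%R]big1 ?addr0.
  rewrite mevalM mevalC rmorph_prod /= big1 ?mulr1 // => j jD.
  by rewrite litE !inE jD eqxx.
move=> W /andP[]; rewrite powersetE => WD WW0.
suff [j jD jW] : exists2 j, j \in D & (j \in W) != w j.
  by rewrite mevalM rmorph_prod /= (bigD1 j) //= litE (negPf jW) mul0r mulr0.
apply/exists_inP; apply: contraNT WW0 => /exists_inPn hW.
apply/eqP/setP => j; rewrite !inE.
have [jD|jD] := boolP (j \in D); first by move: (hW j jD); rewrite negbK => /eqP.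
by apply: contraNF jD => /(subsetP WD).
Qed.

(** [phi i W] is the value that Lea forbids for coordinate i when W is the
    support of the later coordinates. The hypothesis says that respecting all
    these prohibitions always leads outside the given set of points. *)
Lemma lex_leading_of_strategy (n : nat) (Sw : {set {ffun 'I_n -> bool}})
    (T : {set 'I_n}) (phi : 'I_n -> {set 'I_n} -> bool) :
  (forall w, w \in Sw ->
     exists2 i, i \in T & w i = phi i [set j : 'I_n | (i < j) && w j]) ->
  lex_leading_monomial [fset bool_point w | w in Sw]%fset (xmon T).
Proof.
move=> win.
have /fin_all_exists2[q qvars qE] : forall i : 'I_n,
    exists2 q : {mpoly rat[n]}, vars_in [set j : 'I_n | i < j] q &
    forall w : {ffun 'I_n -> bool}, q.@[bool_point w 0%R]%R =
       ((phi i ([set j : 'I_n | i < j]%N :&: [set j | w j]))%:R)%R.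
  by move=> i; apply: (interpolation _ (fun W => ((phi i W)%:R)%R)).
pose f : {mpoly rat[n]} := (\prod_(i in T) ('X_i - q i))%R.
have fmonic : lex_monic (xmon T) f.
  rewrite /f /xmon; apply: (big_ind2 (@lex_monic n)).
  - exact: lex_monic1.
  - by move=> m1 m2 f1 f2; apply: lex_monicM.
  move=> i _ m; have -> : ('X_i - q i - 'X_i = - q i)%R by ring.
  rewrite (perm_mem (msuppN _)) => mq; have m0 := qvars i m mq.
  apply/lex_ltP; exists i => [|j ji].
    by rewrite m0 ?mnm1E ?eqxx // inE ltnn.
  rewrite m0 ?mnm1E; last by rewrite inE -leqNgt ltnW.
  by case: eqP => // ij; rewrite ij ltnn in ji.
have flead := lex_monic_lead fmonic.
exists f; split=> //; first by apply: contraTneq flead.1 => ->; rewrite msupp0.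
move=> v /imfsetP[w /= wS ->].
have [i iT wi] := win w wS.
rewrite /f rmorph_prod /= (bigD1 i) //= mevalB mevalXU qE mxE wi.
have -> : [set j : 'I_n | i < j] :&: [set j | w j] = [set j : 'I_n | (i < j) && w j].
  by apply/setP => j; rewrite !inE.
by rewrite subrr mul0r.
Qed.

(** * The game for a linear congruence *)

(** When s is the sum of the terms already fixed, this says that the missing
    contribution k - s belongs modulo p to the interval from lo to hi; it is
    phrased without subtraction. If hi < lo it is false. *)
Definition in_arc (p k lo hi s : nat) : bool :=
  [exists y : 'I_hi.+1, (lo <= y) && (y + s == k %[mod p])].

Lemma in_arcP (p k lo hi s : nat) :
  reflect (exists2 y, lo <= y <= hi & y + s = k %[mod p]) (in_arc p k lo hi s).
Proof.
apply: (iffP existsP) => [[y /andP[loy /eqP e]]|[y /andP[loy yhi] e]].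
  by exists y => //; rewrite loy -ltnS ltn_ord.
by exists (Ordinal (yhi : y < hi.+1)); rewrite loy /=; apply/eqP.
Qed.

Lemma in_arc_free (p k lo hi c s : nat) (b : bool) :
  in_arc p k lo hi (c * b + s) -> in_arc p k lo (hi + c) s.
Proof.
move=> /in_arcP[y ylohi e]; apply/in_arcP; exists (y + c * b); last by rewrite -addnA.
by case: b {e}; lia.
Qed.

Lemma eq_of_eq_mod (p x y : nat) :
  x = y %[mod p] -> x < p + y -> y < p + x -> x = y.
Proof.
wlog xy : x y / x <= y.
  by move=> H; case: (leqP x y) => h *; [|apply/esym]; apply: H => //; apply: ltnW.
move=> /esym/eqP; rewrite eqn_mod_dvd // => dv h1 h2.
case: (posnP (y - x)) => [|pos]; first by lia.
by have := dvdn_leq pos dv; lia.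
Qed.

(** The missing contribution is both in the interval and in its translate by c.
    Integers of these two intervals that agree modulo p differ by at most
    hi + c - lo < p, so they are equal. *)
Lemma in_arc_forced (p k lo hi c s : nat) :
  hi + c < p + lo ->
  in_arc p k lo hi s -> in_arc p k lo hi (c + s) -> in_arc p k (lo + c) hi s.
Proof.
move=> small /in_arcP[y1 b1 e1] /in_arcP[y2 b2 e2].
have e : y1 = y2 + c %[mod p].
  by apply/eqP; rewrite -(eqn_modDr s) e1 -addnA e2.
have {}e := eq_of_eq_mod e ltac:(lia) ltac:(lia).
by apply/in_arcP; exists y1 => //; lia.
Qed.

Lemma below_recr (n : nat) (i : 'I_n) (P : pred 'I_n) (F : 'I_n -> nat) :
  \sum_(j < n | (j < i.+1) && P j) F j =
  \sum_(j < n | (j < i) && P j) F j + (if P i then F i else 0).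
Proof.
rewrite [LHS]big_mkcond /= (bigD1 i) //= ltnSn /= addnC; congr (_ + _).
rewrite [RHS]big_mkcond [RHS](bigD1 i) //= ltnn /= add0n.
apply: eq_bigr => j ji; rewrite ltnS leq_eqVlt.
by rewrite (inj_eq val_inj) (negPf ji).
Qed.

Lemma above_recl (n : nat) (i : 'I_n) (F : 'I_n -> nat) :
  \sum_(j < n | i <= j) F j = F i + \sum_(j < n | i < j) F j.
Proof.
rewrite (bigD1 i) //=; congr (_ + _); apply: eq_bigl => j.
by rewrite ltn_neqAle andbC eq_sym.
Qed.

Definition below (n : nat) (a : 'I_n -> nat) (P : {set 'I_n}) (i : nat) : nat :=
  \sum_(j < n | (j < i) && (j \in P)) a j.

(** Lea forbids w_i = 0 when the contribution still missing is in the interval,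
    for then w_i = 0 would leave it there, and forbids w_i = 1 otherwise. *)
Definition lea_forbids (n p k : nat) (a : 'I_n -> nat) (T : {set 'I_n})
    (i : 'I_n) (W : {set 'I_n}) : bool :=
  ~~ in_arc p k (below a T i) (below a (~: T) i) (\sum_(j in W) a j).

(** By contraposition: if w satisfies the congruence and all prohibitions, then
    by induction on i the contribution of the coordinates before i is in the
    interval for i, but the interval for M is empty. *)
Lemma lea_wins (n p k : nat) (a : 'I_n -> nat) (T : {set 'I_n}) (M : nat)
    (w : {ffun 'I_n -> bool}) :
  M <= n ->
  (forall i, i \in T -> below a (~: T) i + a i < p + below a T i) ->
  below a (~: T) M < below a T M ->
  \sum_(i < n) a i * w i = k %[mod p] ->
  exists2 i, i \in T &
    w i = lea_forbids p k a T i [set j : 'I_n | (i < j) && w j].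
Proof.
move=> Mn small short wk; pose f i := lea_forbids p k a T i [set j : 'I_n | (i < j) && w j].
have [/exists_inP[i iT /eqP wi]|/exists_inPn hw] :=
  boolP [exists i in T, w i == f i]; first by exists i.
suff : below a T M <= below a (~: T) M by rewrite leqNgt short.
suff inv i : i <= M ->
    in_arc p k (below a T i) (below a (~: T) i) (\sum_(j < n | i <= j) a j * w j).
  by have /in_arcP[y /andP[+ +] _] := inv M (leqnn M); apply: leq_trans.
elim: i => [_|i IH iM].
  by apply/in_arcP; exists 0; rewrite // /below big_pred0.
have iltn : i < n by apply: leq_trans iM Mn.
have := IH (ltnW iM); rewrite -[i]/(val (Ordinal iltn)).
move: (Ordinal iltn) => {}i {IH iltn iM} /=.
rewrite /below !(below_recr i) above_recl -!/(below _ _ _) inE.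
have [iT|iT] /= := boolP (i \in T); last by rewrite addn0; apply: in_arc_free.
have sumE : \sum_(j in [set j : 'I_n | (i < j) && w j]) a j
          = \sum_(j < n | i < j) a j * w j.
  rewrite (eq_bigl _ _ (fun j => in_set _ j)) big_mkcondr.
  by apply: eq_bigr => j _; case: (w j); rewrite ?muln1 ?muln0.
move: (hw i iT); rewrite /f /lea_forbids sumE addn0.
(* As w_i respects the prohibition, it is 1 if the contribution missing after
   i is in the interval; otherwise it is 0, which contradicts the invariant. *)
case: (boolP (in_arc _ _ _ _ _)) => arc; case: (w i) => //= _ .
  by rewrite muln1; apply: in_arc_forced (small i iT) arc.
by rewrite muln0 add0n (negPf arc).
Qed.

(** * Ballot condition and domination *)

(** Cut the weights into unit layers: the sum over Z is the sum over c of the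
    number of z in Z with c < a z. As a is nondecreasing, a nonempty layer
    contains exactly the indices from some i on, and there the hypothesis applies. *)
Lemma sum_dominated (n : nat) (a : 'I_n -> nat) (X Y : {set 'I_n}) :
  (forall i j : 'I_n, i <= j -> a i <= a j) ->
  (forall i : 'I_n, #|[set x in X | i <= x]| <= #|[set y in Y | i <= y]|) ->
  \sum_(x in X) a x <= \sum_(y in Y) a y.
Proof.
move=> a_mono dom; pose N := \max_i a i.
have layers (Z : {set 'I_n}) :
    \sum_(z in Z) a z = \sum_(c < N) #|[set z in Z | c < a z]|.
  transitivity (\sum_(z in Z) \sum_(c < N) (c < a z)).
    apply: eq_bigr => z _; have az : a z <= N by apply: leq_bigmax.
    rewrite -big_mkcond /= -(big_ord_widen _ (fun=> 1) az).
    by rewrite sum1_card card_ord.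
  rewrite exchange_big; apply: eq_bigr => c _.
  by rewrite -big_mkcondr sum1dep_card.
rewrite !layers; apply: leq_sum => c _.
case: (pickP (fun z : 'I_n => c < a z)) => [z0 cz0|none]; last first.
  by rewrite [X in X <= _](_ : _ = 0) //; apply: eq_card0 => z; rewrite inE none andbF.
case: (@arg_minnP _ z0 (fun z => c < a z) val cz0) => i ci imin.
have layerE (Z : {set 'I_n}) :
    [set z in Z | c < a z] = [set z in Z | i <= z].
  apply/setP => z; rewrite !inE; congr (_ && _).
  by apply/idP/idP => [/imin|/a_mono]; last exact: leq_trans.
by rewrite !layerE.
Qed.

Lemma enum_succ_sorted (n : nat) (T : {set 'I_n}) :
  sorted leq [seq (val x).+1 | x <- enum T].
Proof.
rewrite (map_comp succn val) sorted_map.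
apply: (sub_sorted (e := leq)) => [x y|]; first by rewrite /= ltnS.
rewrite sorted_map /enum_mem -enumT.
apply: sorted_filter => [x y z|]; first exact: leq_trans.
by rewrite -(@sorted_map _ _ val leq) val_enum_ord iota_sorted.
Qed.

(** The c-th element of T, counted from 1 and read in {1, ..., n}, is at most i
    when at least c elements of T are among the first i indices. *)
Lemma elt_le (n : nat) (T : {set 'I_n}) (i c : nat) :
  0 < c <= #|[set x in T | x < i]| -> elt T c <= i.
Proof.
move=> /andP[c_gt0 c_le]; rewrite /elt.
apply: (Order.PreorderTheory.nth_count_le (T := nat)); first exact: enum_succ_sorted.
rewrite prednK // (leq_trans c_le) // count_map.
rewrite cardE /enum_mem size_filter count_filter.
by apply: sub_count => x /=; rewrite !inE andbC.
Qed.

Lemma calH_sub (n t : nat) (T : {set 'I_n}) (x : 'I_n) :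
  T \in calH n t -> x \in T -> x < 2 * t - 1.
Proof.
rewrite inE => /and3P[/eqP cardT last_lt _] xT.
set s := [seq (val y).+1 | y <- enum T].
have size_s : size s = t by rewrite size_map -cardE.
have /(nthP 0)[c] : x.+1 \in s by apply: map_f; rewrite mem_enum.
rewrite size_s => ct xE; suff : x.+1 <= elt T t by lia.
rewrite -xE; apply: (sorted_leq_nth leq_trans leqnn 0 (enum_succ_sorted T)).
all: rewrite ?inE ?size_s; lia.
Qed.

(** The ballot condition. If c < t elements of T lie below i, then
    2c <= s_c <= i. The case c >= t cannot occur, since it would give
    s_(t-1) <= i - 1 < 2(t-1). *)
Lemma calH_few_below (n t : nat) (T : {set 'I_n}) (i : nat) :
  T \in calH n t -> i < 2 * t - 1 -> 2 * #|[set x in T | x < i]| <= i.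
Proof.
rewrite inE => /and3P[_ _ /forallP hT] it.
have eltT j : 0 < j < t -> 2 * j <= elt T j.
  by move=> /andP[j0 jt]; move: (hT (Ordinal jt)); rewrite j0 -leqNgt.
set c := #|_|; have [c0|c_gt0] := posnP c; first by rewrite c0.
have [ct|tc] := ltnP c t.
  by have := @elt_le n T i c; have := eltT c; lia.
have c_pred : c <= (#|[set x in T | x < i.-1]|).+1.
  have [iltn|ni] := ltnP i.-1 n; last first.
    apply/leqW/subset_leq_card/subsetP => x; rewrite !inE => /andP[-> _].
    exact: leq_trans (ltn_ord x) ni.
  rewrite -add1n -(cards1 (Ordinal iltn)) (leq_trans _ (leq_card_setU _ _)) //.
  apply/subset_leq_card/subsetP => x; rewrite !inE -val_eqE /=; lia.
have i_gt0 : 0 < i.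
  have /card_gt0P[x] := c_gt0; rewrite inE => /andP[_].
  exact: leq_ltn_trans.
by have := @elt_le n T i.-1 t.-1; have := eltT t.-1; lia.
Qed.

(** By the ballot condition at most t - 1 elements of T lie below the index
    2t - 2, so that index itself is in T. *)
Lemma calH_last (n t : nat) (T : {set 'I_n}) :
  0 < t -> T \in calH n t -> exists2 x, x \in T & x.+1 = 2 * t - 1.
Proof.
move=> t_gt0 HT; have few := @calH_few_below n t T (2 * t - 2) HT ltac:(lia).
have cardT : #|T| = t by move: HT; rewrite inE => /and3P[/eqP].
have : ~~ (T \subset [set x in T | x < 2 * t - 2]).
  by apply/negP => /subset_leq_card; lia.
case/subsetPn => x xT; rewrite inE xT /= => xge.
by exists x => //; have := calH_sub HT xT; lia.
Qed.

Lemma card_ord_lt (n m : nat) : m <= n -> #|[set x : 'I_n | x < m]| = m.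
Proof.
move=> mn; rewrite -sum1dep_card -(big_ord_widen n (fun=> 1) mn).
by rewrite sum1_card card_ord.
Qed.

(** The inequality that governs the game. Take j <= i and let A be the number of
    elements of T below j, so that 2A <= j. Up to 2t - 2 there are t - A
    elements of T from j on, and the remaining indices together with i are at
    most (2t - 1 - j) - (t - A) + 1 <= t - A. *)
Lemma calH_dominates (n t : nat) (a : 'I_n -> nat) (T : {set 'I_n}) (i : 'I_n) :
  (forall i j : 'I_n, i <= j -> a i <= a j) ->
  2 * t <= n -> T \in calH n t -> i \in T ->
  below a (~: T) i + a i <= \sum_(x in T) a x.
Proof.
move=> a_mono tn HT iT; have ilt := calH_sub HT iT.
pose X := i |: [set x : 'I_n | x < i & x \in ~: T].
have -> : below a (~: T) i + a i = \sum_(x in X) a x.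
  rewrite big_setU1 ?inE ?ltnn //= addnC; congr (_ + _).
  by apply: eq_bigl => x; rewrite !inE.
apply: sum_dominated => // j.
have [ij|ji] := ltnP i j.
  rewrite [X in X <= _](_ : _ = 0) //; apply: eq_card0 => x; rewrite !inE.
  by case: eqP => [->|_]; lia.
have few := calH_few_below HT (leq_ltn_trans ji ilt).
have cardT : #|T| = t by move: HT; rewrite inE => /and3P[/eqP].
have T_split : #|[set x in T | x < j]| + #|[set x in T | j <= x]| = t.
  rewrite -cardT -(cardsID [set x : 'I_n | x < j] T); congr (_ + _).
    by apply: eq_card => x; rewrite !inE.
  by apply: eq_card => x; rewrite !inE andbC -leqNgt.
pose U := [set x : 'I_n | x < 2 * t - 1] :\: [set x : 'I_n | x < j].
have cardU : #|U| = 2 * t - 1 - j.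
  rewrite cardsD (setIidPr _) ?card_ord_lt //; try lia.
  by apply/subsetP => x; rewrite !inE; lia.
have cardUT : #|U :&: T| = #|[set x in T | j <= x]|.
  apply: eq_card => x; rewrite !inE -leqNgt.
  by have [/(calH_sub HT) ->|] := boolP (x \in T); rewrite ?andbT ?andbF.
have XU : [set x in X | j <= x] \subset i |: (U :\: T).
  apply/subsetP => x; rewrite !inE; case: eqP => //= _.
  by move=> /andP[/andP[xi ->] jx]; rewrite -leqNgt jx (ltn_trans xi).
apply: leq_trans (subset_leq_card XU) _.
rewrite cardsU1 (leq_trans (leq_add (leq_b1 _) (leqnn _))) //.
have UT := cardsID T U; rewrite cardUT cardU in UT.
have arith A B C : 2 * A <= j -> A + B = t -> B + C = 2 * t - 1 - j -> 1 + C <= B.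
  by lia.
exact: arith few T_split UT.
Qed.

Theorem proposition1p4 (n p k : nat) (a : 'I_n -> nat) (t : nat)
    (T : {set 'I_n})
    (n_gt0 : 0 < n) (p_prime : prime p)
    (a_incr : forall i j : 'I_n, val j = (val i).+1 -> 0 < a i <= a j)
    (t_gt0 : 0 < t) (t_le : 2 * t <= n) (HT : T \in calH n t) :
  (\sum_(i in T) a i < p -> lex_leading_monomial (Smod p a k) (xmon T)) /\
  (\sum_(i < n | i < 2 * t - 1) a i <= p ->
   (t = 1 -> \sum_(i < n | i < 2 * t - 1) a i < p) ->
   lex_leading_monomial (Smod p a k) (xmon T)).
Proof.
have a_mono (i j : 'I_n) : i <= j -> a i <= a j.
  case: j => j; elim: j => [|j IH] jn ij.
    by rewrite (_ : i = Ordinal jn) //; apply: val_inj => /=; move: ij => /=; lia.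
  move: ij; rewrite /= leq_eqVlt => /orP[/eqP ij|ij].
    by rewrite (_ : i = Ordinal jn) //; apply: val_inj.
  have := IH (ltnW jn) ij; have := a_incr (Ordinal (ltnW jn)) (Ordinal jn) erefl.
  by move=> /andP[_]; lia.
have a_gt0 i : 0 < a i.
  have n1 : 1 < n by lia.
  have /andP[a0 _] := a_incr (Ordinal n_gt0) (Ordinal n1) erefl.
  exact: leq_trans a0 (a_mono _ _ _).
have belowT : below a T (2 * t - 1) = \sum_(i in T) a i.
  rewrite /below; apply: eq_bigl => x.
  by have [/(calH_sub HT) ->|] := boolP (x \in T); rewrite ?andbF.
(* The coordinates beyond the first 2t - 1 are chosen before all others, by Stan,
   and only lengthen the interval; so it has to be empty already at 2t - 1. *)
have part1 : \sum_(i in T) a i < p -> lex_leading_monomial (Smod p a k) (xmon T).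
  move=> Tp; apply: (@lex_leading_of_strategy _ _ _ (lea_forbids p k a T)) => w.
  rewrite inE => /eqP wk; apply: (@lea_wins _ _ _ _ _ (2 * t - 1)) wk; first lia.
    by move=> i iT; have := calH_dominates a_mono t_le HT iT; lia.
  have [l lT lE] := calH_last t_gt0 HT.
  rewrite belowT -lE /below below_recr inE lT addn0 -/(below _ _ _).
  by have := calH_dominates a_mono t_le HT lT; have := a_gt0 l; lia.
split=> // Sp t1; apply: part1.
have [/t1 //|t_neq1] := eqVneq t 1.
  apply: leq_ltn_trans; rewrite -belowT /below.
  by rewrite big_mkcondr /=; apply: leq_sum => x _; case: ifP.
have splitS : \sum_(i < n | i < 2 * t - 1) a i
            = below a T (2 * t - 1) + below a (~: T) (2 * t - 1).
  rewrite (bigID (mem T)) /=; congr (_ + _).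
  by apply: eq_bigl => x; rewrite inE.
(* For t > 1 the smallest index is outside T, so the sum over T is strictly
   smaller than the sum over the first 2t - 1 indices. *)
pose o := Ordinal n_gt0.
have oNT : o \in ~: T.
  rewrite inE; apply/negP => oT.
  have := @calH_few_below n t T 1 HT ltac:(lia).
  suff : 0 < #|[set x in T | x < 1]| by lia.
  by apply/card_gt0P; exists o; rewrite inE oT.
rewrite -belowT; suff : 0 < below a (~: T) (2 * t - 1) by lia.
rewrite /below (bigD1 o) /=; first by rewrite ltn_addr.
by rewrite oNT andbT; lia.
Qed.
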